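(* Let a probability threshold $\delta_p>0$ be given, let $\mu$ be a language model and $\mathcal{Q}$ a set of training questions. Suppose that for every question $q\in\mathcal{Q}$ the model capacity set $C(q,\delta_p)$ does not intersect the solution set $\mathcal{S}(q)$, i.e. $$C(q,\delta_p)\cap\mathcal{S}(q)=\emptyset,\qquad\forall q\in\mathcal{Q}.$$ Assume that the RL algorithm does not update the model weights if none of the sampled rollouts receives a positive reward (i.e., reward $=1$). Then, when training RL for $T$ steps with $B$ samples per step such that $TB=\Theta(1/\delta_p)$, there is a constant probability that the RL algorithm will not update the model.
   Context: Let $\mathcal{V}$ be the vocabulary set and $\mathcal{V}^*$ the set of finite strings over $\mathcal{V}$. Questions $q$ and trajectories $\tau$ are elements of $\mathcal{V}^*$. For a language model $\mu$, $P_\mu(q,\tau)$ denotes the probability that $\mu$ generates trajectory $\tau$ when conditioned on input question $q$. The reward is a binary function $\mathrm{R}:\mathcal{V}^*\times\mathcal{V}^*\to\{0,1\}$; a rollout $\tau$ sampled for question $q$ receives reward $\mathrm{R}(q,\tau)$. Solution set: $\mathcal{S}(q)=\{\tau\in\mathcal{V}^*\mid\mathrm{R}(q,\tau)=1\}$. Model capacity set (for threshold $\delta_p>0$, model $\mu$ and question $q$): the smallest set of trajectories whose total probability mass is at least $1-\delta_p$, $$C(q,\delta_p)=\arg\min_{S\subseteq\mathcal{V}^*}\Big\{|S|\ \Big|\ \sum_{\tau\in S}P_\mu(q,\tau)\ge 1-\delta_p\Big\}.$$ RL training starts from the model $\mu$ and uses questions from $\mathcal{Q}$; at each of the $T$ steps,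 $B$ rollouts are sampled from the model. *)

(* Defs.v *)
From HB Require Import structures.
From mathcomp Require Import all_boot all_order all_algebra.
From mathcomp Require Import all_classical all_reals all_analysis.

Set Implicit Arguments.
Unset Strict Implicit.
Unset Printing Implicit Defensive.

Import Order.TTheory GRing.Theory Num.Theory.
Import numFieldNormedType.Exports.

Local Open Scope classical_set_scope.
Local Open Scope ring_scope.

(* [mu q tau] is P_mu(q, tau). *)
Record lang_model (R : realType) (V : countType) := LangModel {
  lm_prob :> seq V -> seq V -> R;
  lm_ge0 : forall q tau, 0 <= lm_prob q tau;
  lm_sum1 : forall q, (\esum_(tau in [set: seq V]) (lm_prob q tau)%:E = 1)%E
}.

Definition solution_set (V : countType) (rew : seq V -> seq V -> bool)
    (q : seq V) : set (seq V) :=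
  [set tau | rew q tau = true].

(* The arg min is kept as the set of all minimizers: because of ties the
   smallest set need not be unique. *)
Definition capacity_sets (R : realType) (V : countType) (mu : lang_model R V)
    (q : seq V) (dp : R) : set (set (seq V)) :=
  let heavy := [set S : set (seq V) |
                 ((1 - dp)%:E <= \esum_(tau in S) (mu q tau)%:E)%E] in
  [set C | heavy C /\ forall S, heavy S -> (C #<= S)%card].

(* Language models parametrized by weights; measurability of singletons makes
   "the weights are equal to w" an event. *)
Record model_family (R : realType) (V : countType) (d : measure_display)
    (W : measurableType d) := ModelFamily {
  model_of :> W -> lang_model R V;
  model_of_measurable : forall q tau,
    measurable_fun [set: W] (fun w => model_of w q tau);
  weights_measurable1 : forall w : W, measurable [set w]
}.

(* T steps of RL training from the weights w0, with questions in Q and B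
   rollouts per step, as a stochastic process on (Omega, P).
   [history t] is the sigma-algebra of what is known when the rollouts of step
   t are about to be sampled: the current weights, the questions of that step,
   all earlier rollouts, and any internal randomness of the algorithm. The
   choice of questions and the update of the weights may therefore be adaptive
   and randomized. [rollout_law] says that, conditionally on [history t], the
   rollouts of step t are independent, the b-th one being drawn from the
   current model at its question; it is the defining property
   P(A /\ E) = \int_A P(E | history t) dP of conditional probability. *)
Record rl_run (R : realType) (V : countType) (d : measure_display)
    (W : measurableType d) (model : model_family R V W) (w0 : W)
    (Q : set (seq V)) (T B : nat)
    (d' : measure_display) (Omega : measurableType d')
    (P : probability Omega R) := RLRun {
  history : nat -> set (set Omega);
  weights : nat -> Omega -> W;
  question : nat -> 'I_B -> Omega -> seq V;
  rollout : nat -> 'I_B -> Omega -> seq V;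
  history_sigma : forall t, sigma_algebra [set: Omega] (history t);
  history_measurable : forall t, history t `<=` measurable;
  history_mono : forall t, history t `<=` history t.+1;
  weights_adapted : forall t (Y : set W), (t <= T)%N -> measurable Y ->
    history t (weights t @^-1` Y);
  question_adapted : forall t b q, (t < T)%N ->
    history t [set om | question t b om = q];
  rollout_adapted : forall t b tau, (t < T)%N ->
    history t.+1 [set om | rollout t b om = tau];
  weights_init : forall om, weights 0 om = w0;
  question_in : forall t b om, (t < T)%N -> Q (question t b om);
  rollout_law : forall t (A : set Omega) (x : 'I_B -> seq V),
    (t < T)%N -> history t A ->
    (P (A `&` [set om | forall b, rollout t b om = x b]) =
     \int[P]_(om in A)
       (\prod_(b < B) model (weights t om) (question t b om) (x b))%:E)%E
}.

(* As long as no rollout sampled so far has received reward 1, a step leaves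
   the weights unchanged. Looking at all the rollouts sampled so far, and not
   only at those of the current step, makes this the weaker requirement: it
   allows e.g. replay buffers. *)
Definition no_update_without_reward (R : realType) (V : countType)
    (d : measure_display) (W : measurableType d) (model : model_family R V W)
    (w0 : W) (Q : set (seq V)) (T B : nat) (d' : measure_display)
    (Omega : measurableType d') (P : probability Omega R)
    (rew : seq V -> seq V -> bool)
    (run : rl_run model w0 Q T B P) : Prop :=
  forall t om, (t < T)%N ->
    (forall s b, (s <= t)%N ->
       rew (question run s b om) (rollout run s b om) = false) ->
    weights run t.+1 om = weights run t om.

Definition never_updated (R : realType) (V : countType)
    (d : measure_display) (W : measurableType d) (model : model_family R V W)
    (w0 : W) (Q : set (seq V)) (T B : nat) (d' : measure_display)
    (Omega : measurableType d') (P : probability Omega R)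
    (run : rl_run model w0 Q T B P) : set Omega :=
  [set om | forall t, (t <= T)%N -> weights run t om = w0].

(* Main.v *)
(* As long as no reward has been received the weights are still w0, under which
   a rollout for a question of Q is reward-free with probability at least 1 - dp,
   because the capacity set avoids the solution set. Conditioning on the history
   step by step, all T * B rollouts are reward-free with probability at least
   r ^+ (T * B) for every r < 1 - dp, and r := expR (- (dp / (1 - dmax))) gives
   the constant c := expR (- (k2 / (1 - dmax))). *)
Require Import Defs.
From HB Require Import structures.
From mathcomp Require Import all_boot all_order all_algebra.
From mathcomp Require Import all_classical all_reals all_analysis.

Set Implicit Arguments.
Unset Strict Implicit.
Unset Printing Implicit Defensive.

Import Order.TTheory GRing.Theory Num.Theory.
Import numFieldNormedType.Exports.

Local Open Scope classical_set_scope.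
Local Open Scope ring_scope.

(** * Countably valued maps and products of infinite sums *)

Lemma measurable_preimage_countable (d : measure_display)
    (T : measurableType d) (K : countType) (f : T -> K) (Y : set K) :
  (forall k, measurable [set x | f x = k]) -> measurable (f @^-1` Y).
Proof.
move=> mf.
have -> : f @^-1` Y = \bigcup_(k in Y) [set x | f x = k].
  by apply/seteqP; split=> [x Yx|x [k Yk /= ->]//]; exists (f x).
rewrite bigcup_mkcond; apply: countable_bigcupT_measurable => // k.
by case: ifP.
Qed.

(** Each infinite sum is a supremum of finite partial sums, so it already exceeds [r] on some finite
    list [l i]. Expanding the product of these finite sums yields one term per choice function, and
    [s] lists these functions. *)
Lemma prod_esum_gt (R : realType) (I : finType) (K : choiceType)
    (S : I -> set K) (f : I -> K -> R) (r : R) :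
  (forall i k, 0 <= f i k) -> 0 <= r ->
  (forall i, (r%:E < \esum_(k in S i) (f i k)%:E)%E) ->
  exists s : seq {ffun I -> K},
    [/\ uniq s, forall x, x \in s -> forall i, S i (x i) &
        r ^+ #|I| <= \sum_(x <- s) \prod_i f i (x i)].
Proof.
move=> f0 r0 rS.
have /boolp.choice[l lP] : forall i, exists li : seq K,
    [/\ uniq li, forall k, k \in li -> S i k & r < \sum_(k <- li) f i k].
  move=> i.
  have [_ [F [/finite_seqP[l Fl] FS] <-] rF] := ereal_sup_gt (rS i).
  exists (undup l); split.
  - exact: undup_uniq.
  - by move=> k; rewrite mem_undup => kl; apply: FS; rewrite Fl.
  - have FE : F = [set` undup l] by rewrite Fl; apply/seteqP; split=> k /=; rewrite mem_undup.
    by move: rF; rewrite FE -fsbig_seq ?undup_uniq//= sumEFin lte_fin.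
(* Distributing a product over sums requires a finite index type, while [K] may be infinite;
   [seq_sub U] is a finite type holding all the lists at once. *)
pose U := flatten [seq l i | i <- enum I].
have lU i k : k \in l i -> k \in U.
  by move=> kl; apply/flatten_mapP; exists i; rewrite ?mem_enum.
pose s := [seq [ffun i => val (g i)] | g : {ffun I -> seq_sub U} in
  family (fun i => [pred j : seq_sub U | val j \in l i])].
exists s; split.
- rewrite map_inj_uniq ?enum_uniq// => g h /ffunP gh.
  by apply/ffunP => i; apply: val_inj; have := gh i; rewrite !ffunE.
- move=> x /mapP[g]; rewrite mem_enum => /familyP gl -> i; rewrite ffunE.
  by have [_ + _] := lP i; apply; exact: gl.
- rewrite big_map big_enum/=.
  under eq_bigr do under eq_bigr do rewrite ffunE.
  rewrite -(bigA_distr_big_dep _ (fun i (j : seq_sub U) => f i (val j))).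
  rewrite -prodr_const; apply: ler_prod => i _; rewrite r0/=.
  have [ul _ /ltW] := lP i; move/le_trans; apply; rewrite le_eqVlt.
  apply/orP; left; rewrite -big_enum -(big_map val xpredT)/=; apply/eqP.
  apply: perm_big; apply: uniq_perm => //.
    by rewrite map_inj_uniq ?enum_uniq//; exact: val_inj.
  move=> k; apply/idP/mapP => [kl|[j]].
    by exists (SeqSub (lU _ _ kl)); rewrite // mem_enum.
  by rewrite mem_enum => ? ->.
Qed.

(** The fibers of [f] form a countable measurable partition, so by countable additivity the
    inequality can be checked fiber by fiber. *)
Lemma measure_le_fibers (d : measure_display) (T : measurableType d)
    (R : realType) (mu : {measure set T -> \bar R}) (K : countType)
    (f : T -> K) (A B : set T) (c : R) :
  0 <= c ->
  (forall k, measurable [set x | f x = k]) -> measurable A -> measurable B ->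
  (forall k, c%:E * mu (A `&` [set x | f x = k]) <=
             mu (B `&` [set x | f x = k]))%E ->
  (c%:E * mu A <= mu B)%E.
Proof.
move=> c0 mf mA mB cAB.
(* Fibers are indexed by their codes in [nat] to obtain a series; a code that [f] never attains
   gives an empty set. *)
pose E n := (pickle \o f) @^-1` [set n].
have mE n : measurable (E n).
  have := measurable_preimage_countable [set k | pickle k = n] mf.
  exact.
have EE X : X = \bigcup_n (X `&` E n).
  by apply/seteqP; split=> [x Xx|x [n _ []]//]; exists (pickle (f x)).
have muE X : measurable X -> mu X = (\sum_(0 <= n <oo) mu (X `&` E n))%E.
  move=> mX; rewrite {1}(EE X) measure_bigcup//.
  - by apply: eq_eseriesl => n; rewrite in_setT.
  - by move=> n _; exact: measurableI.
  - by move=> m n _ _ [x [[_ <-] [_ <-]]].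
rewrite (muE A)// (muE B)// -nneseriesZl//; apply: lee_nneseries => [n _ _|n _].
  by rewrite mule_ge0.
have [[x <-]|En0] := pselect (exists x, E n x); last first.
  suff -> : E n = set0 by rewrite !setI0 !measure0 mule0.
  by rewrite -subset0 => x Enx; apply: En0; exists x.
suff -> : E ((pickle \o f) x) = [set y | f y = f x] by exact: cAB.
by apply/seteqP; split=> y; rewrite /E/=; [move=> /(pcan_inj pickleK)|move->].
Qed.

(** * Probability of a reward-free run *)

Section reward_free_run.
Variables (R : realType) (V : countType) (d : measure_display)
  (W : measurableType d) (model : model_family R V W) (w0 : W)
  (Q : set (seq V)) (T B : nat) (d' : measure_display)
  (Omega : measurableType d') (P : probability Omega R)
  (rew : seq V -> seq V -> bool) (run : rl_run model w0 Q T B P).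

Definition no_reward_at (t : nat) : set Omega :=
  [set om | forall b, rew (question run t b om) (rollout run t b om) = false].

Definition no_reward_before (t : nat) : set Omega :=
  [set om | forall s, (s < t)%N -> no_reward_at s om].

Lemma no_reward_beforeS t :
  no_reward_before t.+1 = no_reward_before t `&` no_reward_at t.
Proof.
apply/seteqP; split=> [om G|om [G Gt] s].
  by split=> [s st|]; apply: G => //; exact: ltnW.
by rewrite ltnS leq_eqVlt => /predU1P[->//|]; exact: G.
Qed.

Lemma history_le s t : (s <= t)%N -> history run s `<=` history run t.
Proof.
move=> /subnK <-; elim: (t - s)%N => [//|n IH].
by rewrite addSn; apply: subset_trans IH _; exact: history_mono.
Qed.

(** This lets the general closure lemmas for measurable sets be applied to [history run t]. *)
Lemma measurable_historyE t :
  (history run t).-sigma.-measurable = history run t.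
Proof. exact/measurable_g_measurableTypeE/history_sigma. Qed.

(** The event depends on finitely many pairs of a question and a rollout, each with countably many
    values. The index is [t.+1] because the rollouts of step [t] are known only after that step. *)
Lemma history_no_reward_at t : (t < T)%N ->
  history run t.+1 (no_reward_at t).
Proof.
move=> tT; rewrite -measurable_historyE.
have -> : no_reward_at t = \bigcap_(b in [set: 'I_B])
    ((fun om => (question run t b om, rollout run t b om)) @^-1`
     [set qx | rew qx.1 qx.2 = false]).
  by apply/seteqP; split=> om G b; [move=> _; exact: G|exact: (G b I)].
apply: fin_bigcap_measurable => [|b _]; first exact: finite_finset.
apply: (@measurable_preimage_countable _
  (g_sigma_algebraType (history run t.+1))) => -[q x].
have -> : [set om | (question run t b om, rollout run t b om) = (q, x)] =
    [set om | question run t b om = q] `&` [set om | rollout run t b om = x].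
  by apply/seteqP; split=> om /= [-> ->].
apply: (@measurableI _ (g_sigma_algebraType (history run t.+1)));
  rewrite measurable_historyE; last exact: rollout_adapted.
exact/history_mono/question_adapted.
Qed.

Lemma history_no_reward_before t : (t <= T)%N ->
  history run t (no_reward_before t).
Proof.
move=> tT; rewrite -measurable_historyE.
have -> : no_reward_before t = \bigcap_(s in [set` 'I_t]) no_reward_at s.
  apply/seteqP; split=> om G s; first by move=> _; exact/G/ltn_ord.
  by move=> st; exact: (G (Ordinal st)).
apply: fin_bigcap_measurable => [|s _]; first exact: finite_finset.
rewrite measurable_historyE; have /history_le := ltn_ord s; apply.
by apply: history_no_reward_at; exact: leq_trans tT.
Qed.

Lemma weights_no_reward t om : no_update_without_reward rew run ->
  (t <= T)%N -> no_reward_before t om -> weights run t om = w0.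
Proof.
move=> stay; elim: t => [*|t IH tT G]; first exact: weights_init.
rewrite stay// => [|s b st]; last exact: G.
by apply: IH (ltnW tT) _ => s st; apply: G; exact: ltnW.
Qed.

(* The strict inequality leaves room to replace the reward-free mass of each
   question by that of a finite set, so that only finitely many joint rollouts
   have to be summed. *)
Lemma no_reward_step (r : R) t : no_update_without_reward rew run ->
  0 <= r ->
  (forall q, Q q ->
    (r%:E < \esum_(x in [set x | rew q x = false]) (model w0 q x)%:E)%E) ->
  (t < T)%N ->
  ((r ^+ B)%:E * P (no_reward_before t) <= P (no_reward_before t.+1))%E.
Proof.
move=> stay r0 rQ tT.
(* Conditioning on the whole vector of questions makes them constant on each fiber, and this vector
   has countably many values. *)
pose f om := [ffun b => question run t b om].
have fE q : [set om | f om = q] =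
    \bigcap_(b in [set: 'I_B]) [set om | question run t b om = q b].
  apply/seteqP; split=> om /= => [<- b _|G]; first by rewrite /f/= ffunE.
  by apply/ffunP => b; rewrite ffunE; exact: G.
have hf q : history run t [set om | f om = q].
  rewrite -measurable_historyE fE.
  apply: fin_bigcap_measurable => [|b _]; first exact: finite_finset.
  by rewrite measurable_historyE; exact: question_adapted.
have mG s : (s <= T)%N -> measurable (no_reward_before s).
  by move=> sT; apply: history_measurable (history_no_reward_before sT).
apply: (measure_le_fibers (f := f)) => //; first exact: exprn_ge0.
- by move=> q; apply: history_measurable (hf q).
- by apply: mG; exact: ltnW.
- exact: mG.
move=> q; set A := _ `&` _.
have hA : history run t A.
  rewrite -measurable_historyE.
  by apply: (@measurableI _ (g_sigma_algebraType (history run t)));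
    rewrite measurable_historyE//; apply: history_no_reward_before; exact: ltnW.
have mA : measurable A by exact: history_measurable hA.
(* An outcome in [A] is what shows that every [q b] lies in [Q]; without one, both sides are
   trivially comparable. *)
have [[om0 [_ om0q]]|A0] := pselect (exists om, A om); last first.
  suff -> : A = set0 by rewrite measure0 mule0.
  by rewrite -subset0 => om Aom; apply: A0; exists om.
have Qq b : Q (q b) by rewrite -om0q ffunE; exact: question_in.
have [s [us sS rs]] := prod_esum_gt (fun b => lm_ge0 (model w0) (q b)) r0
  (fun b => rQ _ (Qq b)).
pose E (x : {ffun 'I_B -> seq V}) :=
  A `&` [set om | forall b, rollout run t b om = x b].
have mE x : measurable (E x).
  apply: measurableI => //.
  have -> : [set om | forall b, rollout run t b om = x b] =
      \bigcap_(b in [set: 'I_B]) [set om | rollout run t b om = x b].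
    by apply/seteqP; split=> om G b; [move=> _; exact: G|exact: (G b I)].
  apply: fin_bigcap_measurable => [|b _]; first exact: finite_finset.
  by apply: history_measurable (rollout_adapted run b (x b) tT).
(* On [A] the weights are still [w0] and the questions are [q], so the integrand of [rollout_law] is
   constant. *)
have PE x : P (E x) = ((\prod_b model w0 (q b) (x b))%:E * P A)%E.
  rewrite rollout_law// -integral_cst//; apply: eq_integral => om.
  rewrite inE => -[G /= omq]; rewrite (weights_no_reward stay (ltnW tT) G).
  by congr (_%:E); apply: eq_bigr => b _; rewrite -omq ffunE.
have EG : \bigcup_(x in [set` s]) E x `<=`
    no_reward_before t.+1 `&` [set om | f om = q].
  move=> om [x /= xs [[G omq] omx]]; split=> //; rewrite no_reward_beforeS.
  split=> // b; rewrite omx; have /= := sS _ xs b.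
  by rewrite -omq ffunE.
(* The events [E x] are pairwise disjoint, so their probabilities add up, and the choice of [s]
   bounds the sum below by [r ^+ B] times [P A]. *)
apply: le_trans (le_measure P _ _ EG); last 2 first.
- by rewrite inE; apply: fin_bigcup_measurable => //; exact: finite_seq.
- rewrite inE; apply: measurableI; first exact: mG.
  by apply: history_measurable (hf q).
rewrite measure_fin_bigcup//; last 2 first.
- exact: finite_seq.
- move=> x y _ _ [om [[_ omx] [_ omy]]].
  by apply/ffunP => b; rewrite -omx -omy.
rewrite -fsbig_seq//; rewrite (eq_bigr _ (fun x _ => PE x)).
rewrite -ge0_sume_distrl; last first.
  by move=> x _; rewrite lee_fin prodr_ge0// => b _; exact: lm_ge0.
by rewrite sumEFin; apply: lee_wpmul2r; rewrite // lee_fin -[X in r ^+ X]card_ord.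
Qed.

Lemma no_reward_before_ge (r : R) t : no_update_without_reward rew run ->
  0 <= r ->
  (forall q, Q q ->
    (r%:E < \esum_(x in [set x | rew q x = false]) (model w0 q x)%:E)%E) ->
  (t <= T)%N -> ((r ^+ (t * B))%:E <= P (no_reward_before t))%E.
Proof.
move=> stay r0 rQ; elim: t => [_|t IH tT].
  rewrite mul0n expr0 [X in P X](_ : _ = setT) ?probability_setT//.
  by apply/seteqP; split.
apply: le_trans (no_reward_step stay r0 rQ tT).
rewrite mulSn exprD EFinM; apply: lee_wpmul2l (IH (ltnW tT)).
by rewrite lee_fin exprn_ge0.
Qed.

Lemma measurable_never_updated : measurable (never_updated run).
Proof.
have -> : never_updated run =
    \bigcap_(t in `I_T.+1) (weights run t @^-1` [set w0]).
  by apply/seteqP; split.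
apply: fin_bigcap_measurable => [|t tT]; first exact: finite_II.
apply: history_measurable (weights_adapted run tT _).
exact: (weights_measurable1 model).
Qed.

Lemma no_reward_never_updated : no_update_without_reward rew run ->
  no_reward_before T `<=` never_updated run.
Proof.
move=> stay om G t tT; apply: weights_no_reward => // s st.
by apply: G; exact: leq_trans tT.
Qed.

End reward_free_run.

(** * The constant lower bound *)

(** After inversion this is 1/(1-p) = 1 + p/(1-p) < exp(p/(1-p)) <= exp(p/(1-a)). *)
Lemma expR_lt_1B (R : realType) (p a : R) : 0 < p -> p <= a -> a < 1 ->
  expR (- (p / (1 - a))) < 1 - p.
Proof.
move=> p0 pa a1; have p1 : 0 < 1 - p by rewrite subr_gt0 (le_lt_trans pa).
rewrite expRN invf_plt ?posrE ?expR_gt0//.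
have -> : (1 - p)^-1 = 1 + p / (1 - p).
  by apply: (mulIf (lt0r_neq0 p1)); rewrite mulVf ?lt0r_neq0// mulrDl mul1r
    divfK ?lt0r_neq0// subrK.
apply: lt_le_trans (expR_gt1Dx _) _; first by rewrite gt_eqF// divr_gt0.
rewrite ler_expR; apply: ler_wpM2l; first exact: ltW.
by rewrite lef_pV2 ?posrE// ?subr_gt0// lerD2l lerN2.
Qed.

(* k1, k2 are the constants hidden in T * B = Theta(1 / dp); the probability c
   depends only on them and on an arbitrary bound dmax < 1 on dp. *)
Theorem theorem4p4 (R : realType) (k1 k2 dmax : R)
  (hk1 : 0 < k1) (hk12 : k1 <= k2) (hdmax : dmax < 1) :
  exists c : R, 0 < c /\
  forall (V : countType) (d : measure_display) (W : measurableType d)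
    (model : model_family R V W) (w0 : W)
    (rew : seq V -> seq V -> bool) (Q : set (seq V))
    (dp : R) (C : seq V -> set (seq V)) (T B : nat)
    (d' : measure_display) (Omega : measurableType d')
    (P : probability Omega R) (run : rl_run model w0 Q T B P),
  0 < dp -> dp <= dmax ->
  (forall q, Q q -> capacity_sets (model w0) q dp (C q)) ->
  (forall q, Q q -> C q `&` solution_set rew q = set0) ->
  no_update_without_reward rew run ->
  k1 / dp <= (T * B)%:R -> (T * B)%:R <= k2 / dp ->
  (c%:E <= P (never_updated run))%E.
Proof.
exists (expR (- (k2 / (1 - dmax)))); split; first exact: expR_gt0.
move=> V d W model w0 rew Q dp C T B d' Omega P run dp0 dpmax capC CS stay _ TB.
have a0 : 0 < 1 - dmax by rewrite subr_gt0.
pose r := expR (- (dp / (1 - dmax))).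
have heavy q : Q q ->
    (r%:E < \esum_(x in [set x | rew q x = false]) (model w0 q x)%:E)%E.
  move=> Qq; have [mC _] := capC _ Qq.
  apply: lt_le_trans (le_trans mC _); first by rewrite lte_fin expR_lt_1B.
  (* Every finite subset of [C q] consists of reward-free trajectories, so the mass of [C q] is at
     most the reward-free mass. *)
  apply: ereal_sup_le => _ [F [finF FC] <-]; exists F => //; split=> // x Fx /=.
  apply/negbTE/negP => rx; suff : set0 x by [].
  by rewrite -(CS _ Qq); split=> //; exact: FC.
apply: (@le_trans _ _ (r ^+ (T * B))%:E).
  (* The exponent of [r ^+ (T * B)] is [- (T * B * dp / (1 - dmax))], and [T * B * dp] is at most
     [k2]. *)
  rewrite lee_fin -expRM_natl ler_expR mulrN lerN2 mulrA ler_pM2r ?invr_gt0//.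
  by rewrite -ler_pdivlMr.
apply: le_trans (no_reward_before_ge stay (expR_ge0 _) heavy (leqnn T)) _.
apply: le_measure; rewrite ?inE.
- by apply: history_measurable (history_no_reward_before rew run (leqnn T)).
- exact: measurable_never_updated.
- exact: no_reward_never_updated.
Qed.
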